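(* $SPT_*=\{SPT_n\}_{n\ge0}$, with $SPT_n=PT_{n+1}$, face maps $d_i$ given by deleting the $(i+1)$-th strand and degeneracy maps $s_i$ given by doubling the $(i+1)$-th strand, is a contractible simplicial group.
   Context: For $n\ge 2$ the twin group $T_n$ is generated by $t_1,\dots,t_{n-1}$ with relations $t_i^2=1$ and $t_it_j=t_jt_i$ for $|i-j|\ge 2$; $T_1$ is trivial. Geometrically its elements (twins) are homotopy classes of configurations of $n$ monotone strands in $\mathbb R\times[0,1]$ joining $n$ marked points on $y=1$ to $n$ marked points on $y=0$, with no three strands through a common point; the product is stacking (left factor on top), and $t_i$ is the single crossing of the strands in positions $i,i+1$. For $u\in T_n$ let $\nu(u)\in S_n$ be the permutation such that the strand starting at position $k$ ends at position $\nu(u)(k)$. The pure twin group $PT_n$ is the subgroup of all $u$ with $\nu(u)=1$. For $0\le i\le n$, $d_i:PT_{n+1}\to PT_n$ (for $n\ge1$) deletes the $(i+1)$-th strand; it is the restriction of the map $T_{n+1}\to T_n$ determined by $d_i(uw)=d_i(u)\,d_{\nu(u)(i+1)-1}(w)$ and $d_i(t_j)=t_{j-1}$ if $i+1<j$, $d_i(t_j)=1$ if $i+1\in\{j,j+1\}$, $d_i(t_j)=t_j$ if $i+1>j+1$. For $0\le i\le n$, $s_i:PT_{n+1}\to PT_{n+2}$ doubles the $(i+1)$-th strand (replaces it by two parallel non-crossing copies); it is the restriction of the map determined by $s_i(uw)=s_i(u)\,s_{\nu(u)(i+1)-1}(w)$ and $s_i(t_j)=t_{j+1}$ if $i+1<j$,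 $s_i(t_j)=t_{j+1}t_j$ if $i+1=j$, $s_i(t_j)=t_jt_{j+1}$ if $i+1=j+1$, $s_i(t_j)=t_j$ if $i+1>j+1$. For a simplicial group $G_*$, the Moore cycles are $Z_n(G_* )=\bigcap_{i=0}^n\ker(d_i:G_n\to G_{n-1})$, the Moore boundaries are $B_n(G_* )=d_0\big(\bigcap_{i=1}^{n+1}\ker(d_i:G_{n+1}\to G_n)\big)$, and $\pi_n(G_* )=Z_n(G_* )/B_n(G_* )$. A simplicial group $G_*$ is called contractible if $\pi_n(G_* )=1$ for all $n>0$. *)

(* Defs.v *)
Set Warnings "-notation-overridden".
From HB Require Import structures.
From mathcomp Require Import all_boot perm.
From mathcomp Require Import zify.
From mathcomp Require Import boolp.

Set Warnings "-redundant-canonical-projection,-projection-no-head-constant".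

Set Implicit Arguments.
Unset Strict Implicit.
Unset Printing Implicit Defensive.

Local Open Scope group_scope.
Local Open Scope quotient_scope.

Record simplicial_data := SimplicialData {
  sobj :> nat -> groupType;
  face : forall n, 'I_n.+2 -> sobj n.+1 -> sobj n;
  degen : forall n, 'I_n.+1 -> sobj n -> sobj n.+1 }.

Arguments face X {n} i x : rename.
Arguments degen X {n} i x : rename.

(* All uses of inord below are in range. *)
Record is_simplicial_group (X : simplicial_data) : Prop := IsSimplicialGroup {
  faceM : forall n (i : 'I_n.+2),
    {morph @face X n i : x y / x * y};
  degenM : forall n (i : 'I_n.+1),
    {morph @degen X n i : x y / x * y};
  face_face : forall n (i j : 'I_n.+3) (x : X n.+2), i < j ->
    face X (inord i) (face X j x) = face X (inord j.-1) (face X i x);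
  degen_degen : forall n (i j : 'I_n.+1) (x : X n), i <= j ->
    degen X (inord i) (degen X j x) = degen X (inord j.+1) (degen X i x);
  face_degen_lt : forall n (i : 'I_n.+3) (j : 'I_n.+2) (x : X n.+1), i < j ->
    face X i (degen X j x) = degen X (inord j.-1) (face X (inord i) x);
  face_degen_id : forall n (i : 'I_n.+2) (j : 'I_n.+1) (x : X n),
    (i == j :> nat) || (i == j.+1 :> nat) ->
    face X i (degen X j x) = x;
  face_degen_gt : forall n (i : 'I_n.+3) (j : 'I_n.+2) (x : X n.+1), j.+1 < i ->
    face X i (degen X j x) = degen X (inord j) (face X (inord i.-1) x) }.

Record simplicialGroup := SimplicialGroup {
  sdata :> simplicial_data;
  sdataP : is_simplicial_group sdata }.

Section HomotopyGroups.
Variable X : simplicialGroup.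

Lemma face1 n (i : 'I_n.+2) : face X i 1 = 1.
Proof. by apply: (mulgI (face X i 1)); rewrite -(faceM (sdataP X)) !mulg1. Qed.

Lemma faceV n (i : 'I_n.+2) x : face X i x^-1 = (face X i x)^-1.
Proof.
by apply: (mulgI (face X i x)); rewrite -(faceM (sdataP X)) !mulgV face1.
Qed.

(* In degree 0 there are no face maps, and every element is a cycle. *)
Definition moore_cycle n : pred (X n) :=
  match n with
  | 0 => fun=> true
  | m.+1 => fun x => [forall i : 'I_m.+2, face X i x == 1]
  end.

Definition moore_boundary n (x : X n) : Prop :=
  exists2 y : X n.+1,
    (forall i : 'I_n.+2, i != ord0 -> face X i y = 1) & face X ord0 y = x.

Record moore_cycles n := MooreCycle {
  moore_cycle_val :> X n;
  _ : moore_cycle moore_cycle_val }.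

HB.instance Definition _ n := [isSub for @moore_cycle_val n].
HB.instance Definition _ n := [Choice of moore_cycles n by <:].

Lemma moore_cycle_group n : group_closed (@moore_cycle n).
Proof.
case: n => [|n]; split=> //.
- by apply/forallP => i; rewrite face1.
- move=> x y /forallP xP /forallP yP; apply/forallP => i.
  by rewrite (faceM (sdataP X)) faceV (eqP (xP i)) (eqP (yP i)) invg1 mulg1.
Qed.

HB.instance Definition _ n :=
  SubChoice_isSubGroup.Build (X n) (@moore_cycle n) (moore_cycles n)
    (@moore_cycle_group n).

Lemma moore_cycle_valV n (x : moore_cycles n) : val x^-1 = (val x)^-1.
Proof. by apply: (mulgI (val x)); rewrite -valM !mulgV val1. Qed.

Lemma moore_boundary_cycle n (x : X n) : moore_boundary x -> moore_cycle x.
Proof.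
case: n x => // n x [y yP <-]; apply/forallP => i; apply/eqP.
have i0 : ((ord0 : 'I_n.+3) < lift ord0 i)%N by [].
have := face_face (sdataP X) y i0.
have -> : inord (lift ord0 i).-1 = i by rewrite lift0 /= inord_val.
by rewrite (yP (lift ord0 i)) // face1 => <-.
Qed.

Lemma moore_boundary1 n : moore_boundary (1 : X n).
Proof. by exists 1; first (move=> i _); rewrite face1. Qed.

Lemma moore_boundaryM n (x y : X n) :
  moore_boundary x -> moore_boundary y -> moore_boundary (x * y).
Proof.
move=> [a aP <-] [b bP <-]; exists (a * b); last exact: (faceM (sdataP X)).
by move=> i i0; rewrite (faceM (sdataP X)) aP // bP // mulg1.
Qed.

Lemma moore_boundaryV n (x : X n) : moore_boundary x -> moore_boundary x^-1.
Proof.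
move=> [a aP <-]; exists a^-1; last exact: faceV.
by move=> i i0; rewrite faceV aP // invg1.
Qed.

Lemma moore_boundaryJ n (x z : X n) :
  moore_boundary x -> moore_boundary (x ^ z).
Proof.
move=> [a aP <-]; exists (a ^ degen X ord0 z).
- move=> i i0; rewrite !conjgE !(faceM (sdataP X)) faceV aP //.
  by rewrite mul1g mulVg.
- rewrite !conjgE !(faceM (sdataP X)) faceV.
  by rewrite (face_degen_id (sdataP X)).
Qed.

Definition moore_equiv n (x y : moore_cycles n) : bool :=
  `[< moore_boundary (val x^-1 * val y) >].

Lemma moore_equiv_refl n : reflexive (@moore_equiv n).
Proof.
by move=> x; apply/asboolP; rewrite -valM mulVg val1; apply: moore_boundary1.
Qed.

Lemma moore_equiv_sym n : symmetric (@moore_equiv n).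
Proof.
have sym x y : @moore_equiv n x y -> moore_equiv y x.
  move=> /asboolP /moore_boundaryV xy; apply/asboolP.
  by move: xy; rewrite -!valM -moore_cycle_valV invgM invgK.
by move=> x y; apply/idP/idP; apply: sym.
Qed.

Lemma moore_equiv_trans n : transitive (@moore_equiv n).
Proof.
move=> y x z /asboolP xy /asboolP yz; apply/asboolP.
by move: (moore_boundaryM xy yz); rewrite -!valM -mulgA mulVKg.
Qed.

Canonical moore_equiv_rel n := EquivRel (@moore_equiv n)
  (@moore_equiv_refl n) (@moore_equiv_sym n) (@moore_equiv_trans n).

Definition homotopy_group n : Type := {eq_quot (@moore_equiv_rel n)}.

HB.instance Definition _ n := Choice.on (homotopy_group n).
HB.instance Definition _ n := EqQuotient.on (homotopy_group n).

Definition homotopy_mul n (x y : homotopy_group n) : homotopy_group n :=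
  \pi_(homotopy_group n) (repr x * repr y).
Definition homotopy_inv n (x : homotopy_group n) : homotopy_group n :=
  \pi_(homotopy_group n) (repr x)^-1.
Definition homotopy_one n : homotopy_group n := \pi_(homotopy_group n) 1.

Lemma homotopy_repr n (x : moore_cycles n) :
  moore_boundary (val (repr (\pi_(homotopy_group n) x))^-1 * val x).
Proof. by apply/asboolP/(@eqmodP _ (@moore_equiv_rel n)); rewrite reprK. Qed.

Lemma homotopy_eq n (x y : moore_cycles n) :
  moore_boundary (val x^-1 * val y) ->
  \pi_(homotopy_group n) x = \pi_(homotopy_group n) y.
Proof.
by move=> xy; apply/(@eqmodP _ (@moore_equiv_rel n)); apply/asboolP.
Qed.

Lemma homotopy_mulE n (x y : moore_cycles n) :
  homotopy_mul (\pi_(homotopy_group n) x) (\pi_(homotopy_group n) y) =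
  \pi_(homotopy_group n) (x * y).
Proof.
apply: homotopy_eq.
have := moore_boundaryM (moore_boundaryJ (val (repr (\pi_(homotopy_group n) y)))
  (homotopy_repr x)) (homotopy_repr y).
set a := repr _; set b := repr _.
by rewrite conjgE -!moore_cycle_valV -!valM invgM !mulgA mulgK.
Qed.

Lemma homotopy_invE n (x : moore_cycles n) :
  homotopy_inv (\pi_(homotopy_group n) x) = \pi_(homotopy_group n) x^-1.
Proof.
apply: homotopy_eq.
have := moore_boundaryJ (val x^-1) (moore_boundaryV (homotopy_repr x)).
set a := repr _.
rewrite conjgE -!valM -!moore_cycle_valV -!valM invgM !invgK.
by rewrite !mulgA mulgV mul1g.
Qed.

Lemma homotopy_mulA n : associative (@homotopy_mul n).
Proof.
elim/quotW=> x; elim/quotW=> y; elim/quotW=> z.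
by rewrite (homotopy_mulE y z) (homotopy_mulE x y) !homotopy_mulE mulgA.
Qed.

Lemma homotopy_mul1 n : left_id (@homotopy_one n) (@homotopy_mul n).
Proof. by elim/quotW=> x; rewrite /homotopy_one homotopy_mulE mul1g. Qed.

Lemma homotopy_mulr1 n : right_id (@homotopy_one n) (@homotopy_mul n).
Proof. by elim/quotW=> x; rewrite /homotopy_one homotopy_mulE mulg1. Qed.

Lemma homotopy_mulV n :
  left_inverse (@homotopy_one n) (@homotopy_inv n) (@homotopy_mul n).
Proof.
by elim/quotW=> x; rewrite homotopy_invE homotopy_mulE mulVg.
Qed.

Lemma homotopy_mulrV n :
  right_inverse (@homotopy_one n) (@homotopy_inv n) (@homotopy_mul n).
Proof.
by elim/quotW=> x; rewrite homotopy_invE homotopy_mulE mulgV.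
Qed.

HB.instance Definition _ n := isGroup.Build (homotopy_group n)
  (@homotopy_mulA n) (@homotopy_mul1 n) (@homotopy_mulr1 n)
  (@homotopy_mulV n) (@homotopy_mulrV n).

End HomotopyGroups.

Definition contractible (X : simplicialGroup) : Prop :=
  forall n, 0 < n -> forall x : homotopy_group X n, x = 1.

(* [twin n] is the twin group on n.+1 strands, i.e. T_{n+1}. Strands and
   generators are numbered from 0: the letter j stands for the crossing of the
   strands in positions j and j.+1. *)
Definition twin_word n := seq 'I_n.

Inductive twin_eq n : twin_word n -> twin_word n -> Prop :=
| twin_eq_refl u : twin_eq u u
| twin_eq_sym u v : twin_eq u v -> twin_eq v u
| twin_eq_trans u v w : twin_eq u v -> twin_eq v w -> twin_eq u w
| twin_eq_square u v (i : 'I_n) : twin_eq (u ++ [:: i; i] ++ v) (u ++ v)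
| twin_eq_comm u v (i j : 'I_n) : i.+1 < j ->
    twin_eq (u ++ [:: i; j] ++ v) (u ++ [:: j; i] ++ v).

Definition twin_eqb n (u v : twin_word n) : bool := `[< twin_eq u v >].

Lemma twin_eqb_refl n : reflexive (@twin_eqb n).
Proof. by move=> u; apply/asboolP; apply: twin_eq_refl. Qed.

Lemma twin_eqb_sym n : symmetric (@twin_eqb n).
Proof.
move=> u v.
by apply/idP/idP => /asboolP uv; apply/asboolP; apply: twin_eq_sym.
Qed.

Lemma twin_eqb_trans n : transitive (@twin_eqb n).
Proof.
move=> v u w /asboolP uv /asboolP vw; apply/asboolP.
exact: twin_eq_trans uv vw.
Qed.

Canonical twin_equiv n := EquivRel (@twin_eqb n)
  (@twin_eqb_refl n) (@twin_eqb_sym n) (@twin_eqb_trans n).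

Definition twin n : Type := {eq_quot (@twin_equiv n)}.

HB.instance Definition _ n := Choice.on (twin n).
HB.instance Definition _ n := EqQuotient.on (twin n).

Lemma twin_piP n (u v : twin_word n) :
  \pi_(twin n) u = \pi_(twin n) v <-> twin_eq u v.
Proof.
split=> [/(@eqmodP _ (@twin_equiv n)) /asboolP //|uv].
by apply/(@eqmodP _ (@twin_equiv n)); apply/asboolP.
Qed.

Lemma twin_eq_repr n (u : twin_word n) : twin_eq (repr (\pi_(twin n) u)) u.
Proof. by apply/twin_piP; rewrite reprK. Qed.

Lemma twin_eq_ind_fun n (A : Type) (f : twin_word n -> A) :
    (forall u v i, f (u ++ [:: i; i] ++ v) = f (u ++ v)) ->
    (forall u v (i j : 'I_n), i.+1 < j ->
       f (u ++ [:: i; j] ++ v) = f (u ++ [:: j; i] ++ v)) ->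
  forall u v, twin_eq u v -> f u = f v.
Proof.
by move=> fsq fcomm u v; elim=> {u v} // u v w _ -> _ ->.
Qed.

Lemma twin_eq_cat n (a b u v : twin_word n) :
  twin_eq u v -> twin_eq (a ++ u ++ b) (a ++ v ++ b).
Proof.
elim=> {u v} [u|u v _|u v w _ uv _ vw|u v i|u v i j ij].
- exact: twin_eq_refl.
- exact: twin_eq_sym.
- exact: twin_eq_trans uv vw.
- have := twin_eq_square (a ++ u) (v ++ b) i.
  by rewrite -!catA.
- have := twin_eq_comm (a ++ u) (v ++ b) ij.
  by rewrite -!catA.
Qed.

Lemma twin_eq_cat2 n (u u' v v' : twin_word n) :
  twin_eq u u' -> twin_eq v v' -> twin_eq (u ++ v) (u' ++ v').
Proof.
move=> uu' vv'; apply: (@twin_eq_trans _ _ (u' ++ v)).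
- by have := twin_eq_cat [::] v uu'.
- by have := twin_eq_cat u' [::] vv'; rewrite !cats0.
Qed.

Lemma twin_eq_rev n (u v : twin_word n) :
  twin_eq u v -> twin_eq (rev u) (rev v).
Proof.
elim=> {u v} [u|u v _|u v w _ uv _ vw|u v i|u v i j ij].
- exact: twin_eq_refl.
- exact: twin_eq_sym.
- exact: twin_eq_trans uv vw.
- by rewrite !rev_cat /= -catA; apply: twin_eq_square.
- by rewrite !rev_cat /= -!catA; apply/twin_eq_sym/twin_eq_comm.
Qed.

Lemma twin_eq_catV n (u : twin_word n) : twin_eq (u ++ rev u) [::].
Proof.
elim: u => [|i u IH]; first exact: twin_eq_refl.
rewrite rev_cons -cats1 /=; apply: (@twin_eq_trans _ _ [:: i; i]).
- by have := twin_eq_cat [:: i] [:: i] IH; rewrite /= -catA.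
- exact: (@twin_eq_square _ [::] [::] i).
Qed.

Definition twin_mul n (u v : twin n) : twin n :=
  \pi_(twin n) (repr u ++ repr v).
Definition twin_inv n (u : twin n) : twin n := \pi_(twin n) (rev (repr u)).
Definition twin_one n : twin n := \pi_(twin n) [::].

Lemma twin_mulE n (u v : twin_word n) :
  twin_mul (\pi_(twin n) u) (\pi_(twin n) v) = \pi_(twin n) (u ++ v).
Proof. by apply/twin_piP/twin_eq_cat2; apply: twin_eq_repr. Qed.

Lemma twin_invE n (u : twin_word n) : twin_inv (\pi_(twin n) u) =
  \pi_(twin n) (rev u).
Proof. by apply/twin_piP/twin_eq_rev/twin_eq_repr. Qed.

Lemma twin_mulA n : associative (@twin_mul n).
Proof.
elim/quotW=> x; elim/quotW=> y; elim/quotW=> z.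
by rewrite (twin_mulE y z) (twin_mulE x y) !twin_mulE catA.
Qed.

Lemma twin_mul1 n : left_id (@twin_one n) (@twin_mul n).
Proof. by elim/quotW=> x; rewrite /twin_one twin_mulE. Qed.

Lemma twin_mulr1 n : right_id (@twin_one n) (@twin_mul n).
Proof. by elim/quotW=> x; rewrite /twin_one twin_mulE cats0. Qed.

Lemma twin_mulrV n : right_inverse (@twin_one n) (@twin_inv n) (@twin_mul n).
Proof.
elim/quotW=> x; rewrite twin_invE twin_mulE.
exact/twin_piP/twin_eq_catV.
Qed.

Lemma twin_mulV n : left_inverse (@twin_one n) (@twin_inv n) (@twin_mul n).
Proof.
elim/quotW=> x; rewrite twin_invE twin_mulE; apply/twin_piP.
by rewrite -{2}[x]revK; apply: twin_eq_catV.
Qed.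

HB.instance Definition _ n := isGroup.Build (twin n)
  (@twin_mulA n) (@twin_mul1 n) (@twin_mulr1 n)
  (@twin_mulV n) (@twin_mulrV n).

Lemma twin_piM n (u v : twin_word n) :
  \pi_(twin n) (u ++ v) = \pi_(twin n) u * \pi_(twin n) v.
Proof. by rewrite -twin_mulE. Qed.

Lemma twin_pi1 n : \pi_(twin n) [::] = 1.
Proof. by []. Qed.

(* The generator crossing positions k and k.+1; the indices k >= n, for which
   there is no such generator, never occur below. *)
Definition tgen n (k : nat) : twin n :=
  if insub k is Some j then \pi_(twin n) [:: j] else 1.

Lemma tgenE n (j : 'I_n) : tgen n j = \pi_(twin n) [:: j].
Proof. by rewrite /tgen valK. Qed.

Lemma tgen_square n k : tgen n k * tgen n k = 1.
Proof.
rewrite /tgen; case: insubP => [j _ _|_]; last by rewrite mulg1.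
by rewrite -twin_piM; apply/twin_piP/(@twin_eq_square _ [::] [::]).
Qed.

Lemma tgen_comm n k l : k.+1 < l -> tgen n k * tgen n l = tgen n l * tgen n k.
Proof.
move=> kl; rewrite /tgen.
case: insubP => [i _ ik|_]; last by rewrite mul1g mulg1.
case: insubP => [j _ jl|_]; last by rewrite mul1g mulg1.
rewrite -!twin_piM; apply/twin_piP/(@twin_eq_comm _ [::] [::]).
by rewrite ik jl.
Qed.

(* [nu u k] is the final position of the strand starting in position k. As
   (s * t) x = t (s x) for permutations, this is a morphism for the product
   stacking the left factor on top. *)
Definition nu_gen n (j : 'I_n) : 'S_n.+1 := tperm (inord j) (inord j.+1).

Definition nu_word n (w : twin_word n) : 'S_n.+1 := \prod_(j <- w) nu_gen j.

Definition nu n (u : twin n) : 'S_n.+1 := nu_word (repr u).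

Lemma nu_word_cat n (u v : twin_word n) :
  nu_word (u ++ v) = nu_word u * nu_word v.
Proof. by rewrite /nu_word big_cat. Qed.

Definition nat_swap (j k : nat) : nat :=
  if k == j then j.+1 else if k == j.+1 then j else k.

Lemma nu_genE n (j : 'I_n) (k : 'I_n.+1) : nu_gen j k = nat_swap j k :> nat.
Proof.
have jn := ltn_ord j; rewrite /nu_gen /nat_swap.
have valj : (inord j : 'I_n.+1) = j :> nat by rewrite inordK //; lia.
have valj1 : (inord j.+1 : 'I_n.+1) = j.+1 :> nat by rewrite inordK //; lia.
case: tpermP => [->|->|].
- by rewrite valj eqxx valj1.
- by rewrite valj1 eqxx ifN ?valj //; lia.
- move=> /eqP; rewrite -val_eqE /= valj => /negbTE ->.
  by move=> /eqP; rewrite -val_eqE /= valj1 => /negbTE ->.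
Qed.

Lemma nat_swapP j k :
  k = j /\ nat_swap j k = j.+1 \/ k = j.+1 /\ nat_swap j k = j \/
  (k <> j /\ k <> j.+1) /\ nat_swap j k = k.
Proof. by rewrite /nat_swap; case: eqP => ?; [|case: eqP => ?]; tauto. Qed.

Lemma nat_swapK j : involutive (nat_swap j).
Proof.
move=> k; have := nat_swapP j (nat_swap j k); have := nat_swapP j k; lia.
Qed.

Lemma nat_swapC j l k : j.+1 < l ->
  nat_swap l (nat_swap j k) = nat_swap j (nat_swap l k).
Proof.
have := nat_swapP l (nat_swap j k); have := nat_swapP j (nat_swap l k).
have := nat_swapP l k; have := nat_swapP j k; lia.
Qed.

Lemma nu_word_eq n (u v : twin_word n) : twin_eq u v -> nu_word u = nu_word v.
Proof.
apply: twin_eq_ind_fun => {u v} [u v i|u v i j ij]; rewrite !nu_word_cat.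
- by rewrite /nu_word 2!big_cons big_nil mulg1 tperm2 mul1g.
- congr (_ * (_ * _)); rewrite /nu_word !big_cons big_nil !mulg1.
  apply/permP => k; rewrite !permM; apply: val_inj => /=.
  by rewrite !nu_genE nat_swapC.
Qed.

Lemma nu_pi n (w : twin_word n) : nu (\pi_(twin n) w) = nu_word w.
Proof. exact/nu_word_eq/twin_eq_repr. Qed.

Lemma nuM n : {morph @nu n : u v / u * v}.
Proof.
elim/quotW=> u; elim/quotW=> v.
by rewrite -twin_piM !nu_pi nu_word_cat.
Qed.

Lemma nu1 n : nu (1 : twin n) = 1.
Proof. by rewrite -twin_pi1 nu_pi /nu_word big_nil. Qed.

Lemma nuV n (u : twin n) : nu u^-1 = (nu u)^-1.
Proof. by apply: (mulgI (nu u)); rewrite -nuM !mulgV nu1. Qed.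

Lemma nu_tgen n (j : 'I_n) : nu (tgen n j) = tperm (inord j) (inord j.+1).
Proof. by rewrite tgenE nu_pi /nu_word big_cons big_nil mulg1. Qed.

(* The maps on words only serve to define [twin_face] (deleting strand i) and
   [twin_degen] (doubling strand i), which are characterized by [twin_faceM],
   [twin_face_tgen], [twin_degenM] and [twin_degen_tgen] below. They are crossed
   morphisms on twins, and become morphisms on pure twins. *)

Definition face_gen n (i j : nat) : twin n :=
  if i < j then tgen n j.-1
  else if i <= j.+1 then 1
  else tgen n j.

Fixpoint face_word n (i : 'I_n.+2) (w : twin_word n.+1) : twin n :=
  if w is j :: v then face_gen n i j * face_word (nu_gen j i) v else 1.

Definition twin_face n (i : 'I_n.+2) (u : twin n.+1) : twin n :=
  face_word i (repr u).

Definition degen_gen n (i j : nat) : twin n.+1 :=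
  if i < j then tgen n.+1 j.+1
  else if i == j then tgen n.+1 j.+1 * tgen n.+1 j
  else if i == j.+1 then tgen n.+1 j * tgen n.+1 j.+1
  else tgen n.+1 j.

Fixpoint degen_word n (i : 'I_n.+1) (w : twin_word n) : twin n.+1 :=
  if w is j :: v then degen_gen n i j * degen_word (nu_gen j i) v else 1.

Definition twin_degen n (i : 'I_n.+1) (u : twin n) : twin n.+1 :=
  degen_word i (repr u).

Lemma face_gen_square n i j :
  face_gen n i j * face_gen n (nat_swap j i) j = 1.
Proof.
have := nat_swapP j i; move: (nat_swap j i) => m mP.
rewrite /face_gen; repeat case: ifP => ?; try lia.
all: by rewrite ?mulg1 ?tgen_square.
Qed.

Lemma face_gen_comm n i j k : j.+1 < k ->
  face_gen n i j * face_gen n (nat_swap j i) k =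
  face_gen n i k * face_gen n (nat_swap k i) j.
Proof.
have := nat_swapP k i; move: (nat_swap k i) => l lP.
have := nat_swapP j i; move: (nat_swap j i) => m mP jk.
rewrite /face_gen; repeat case: ifP => ?; try lia.
all: rewrite ?mulg1 ?mul1g //; apply: tgen_comm; lia.
Qed.

Lemma degen_gen_square n i j :
  degen_gen n i j * degen_gen n (nat_swap j i) j = 1.
Proof.
have sq2 k l : tgen n.+1 k * tgen n.+1 l * (tgen n.+1 l * tgen n.+1 k) = 1.
  by rewrite mulgA -(mulgA (tgen n.+1 k)) tgen_square mulg1 tgen_square.
have := nat_swapP j i; move: (nat_swap j i) => m mP.
rewrite /degen_gen; repeat case: ifP => ?; try lia.
all: by rewrite ?sq2 ?tgen_square.
Qed.

Lemma degen_gen_comm n i j k : j.+1 < k ->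
  degen_gen n i j * degen_gen n (nat_swap j i) k =
  degen_gen n i k * degen_gen n (nat_swap k i) j.
Proof.
have := nat_swapP k i; move: (nat_swap k i) => l lP.
have := nat_swapP j i; move: (nat_swap j i) => m mP jk.
rewrite /degen_gen; repeat case: ifP => ?; try lia.
all: try by apply: tgen_comm; lia.
- by apply/esym/commuteM; apply/esym/tgen_comm; lia.
- by apply/esym/commuteM; apply/esym/tgen_comm; lia.
- by apply: commuteM; apply: tgen_comm; lia.
- by apply: commuteM; apply: tgen_comm; lia.
Qed.

Lemma face_word_cat n (i : 'I_n.+2) (u v : twin_word n.+1) :
  face_word i (u ++ v) = face_word i u * face_word (nu_word u i) v.
Proof.
elim: u i => [|j u IH] i /=; first by rewrite mul1g /nu_word big_nil perm1.
by rewrite IH mulgA /nu_word big_cons permM.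
Qed.

Lemma degen_word_cat n (i : 'I_n.+1) (u v : twin_word n) :
  degen_word i (u ++ v) = degen_word i u * degen_word (nu_word u i) v.
Proof.
elim: u i => [|j u IH] i /=; first by rewrite mul1g /nu_word big_nil perm1.
by rewrite IH mulgA /nu_word big_cons permM.
Qed.

Lemma face_word_eq n (i : 'I_n.+2) (u v : twin_word n.+1) :
  twin_eq u v -> face_word i u = face_word i v.
Proof.
apply: twin_eq_ind_fun => {u v} [u v j|u v j k jk];
  rewrite !(face_word_cat i u); set i' := nu_word u i; congr (_ * _).
- have ii : nu_gen j (nu_gen j i') = i'.
    by apply: val_inj; rewrite /= !nu_genE; apply: nat_swapK.
  by rewrite /= ii nu_genE mulgA face_gen_square mul1g.
- have ii : nu_gen k (nu_gen j i') = nu_gen j (nu_gen k i').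
    by apply: val_inj; rewrite /= !nu_genE; apply: nat_swapC.
  by rewrite /= ii !nu_genE !mulgA (face_gen_comm _ _ jk).
Qed.

Lemma degen_word_eq n (i : 'I_n.+1) (u v : twin_word n) :
  twin_eq u v -> degen_word i u = degen_word i v.
Proof.
apply: twin_eq_ind_fun => {u v} [u v j|u v j k jk];
  rewrite !(degen_word_cat i u); set i' := nu_word u i; congr (_ * _).
- have ii : nu_gen j (nu_gen j i') = i'.
    by apply: val_inj; rewrite /= !nu_genE; apply: nat_swapK.
  by rewrite /= ii nu_genE mulgA degen_gen_square mul1g.
- have ii : nu_gen k (nu_gen j i') = nu_gen j (nu_gen k i').
    by apply: val_inj; rewrite /= !nu_genE; apply: nat_swapC.
  by rewrite /= ii !nu_genE !mulgA (degen_gen_comm _ _ jk).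
Qed.

Lemma twin_face_pi n (i : 'I_n.+2) (w : twin_word n.+1) :
  twin_face i (\pi_(twin n.+1) w) = face_word i w.
Proof. exact/face_word_eq/twin_eq_repr. Qed.

Lemma twin_degen_pi n (i : 'I_n.+1) (w : twin_word n) :
  twin_degen i (\pi_(twin n) w) = degen_word i w.
Proof. exact/degen_word_eq/twin_eq_repr. Qed.

Lemma twin_faceM n (i : 'I_n.+2) (u v : twin n.+1) :
  twin_face i (u * v) = twin_face i u * twin_face (nu u i) v.
Proof.
elim/quotW: u => u; elim/quotW: v => v.
by rewrite -twin_piM !twin_face_pi nu_pi face_word_cat.
Qed.

Lemma twin_degenM n (i : 'I_n.+1) (u v : twin n) :
  twin_degen i (u * v) = twin_degen i u * twin_degen (nu u i) v.
Proof.
elim/quotW: u => u; elim/quotW: v => v.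
by rewrite -twin_piM !twin_degen_pi nu_pi degen_word_cat.
Qed.

Lemma twin_face_tgen n (i : 'I_n.+2) (j : 'I_n.+1) :
  twin_face i (tgen n.+1 j) = face_gen n i j.
Proof. by rewrite tgenE twin_face_pi /= mulg1. Qed.

Lemma twin_degen_tgen n (i : 'I_n.+1) (j : 'I_n) :
  twin_degen i (tgen n j) = degen_gen n i j.
Proof. by rewrite tgenE twin_degen_pi /= mulg1. Qed.

Lemma tgen_nuE n j (k : 'I_n.+1) : j < n ->
  nu (tgen n j) k = nat_swap j k :> nat.
Proof.
by move=> jn; rewrite (_ : j = Ordinal jn) // nu_tgen -/(nu_gen _) nu_genE.
Qed.

Lemma nu_face_gen n (i : 'I_n.+2) (j : 'I_n.+1) (k : 'I_n.+1) :
  lift (nu_gen j i) (nu (face_gen n i j) k) = nu_gen j (lift i k).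
Proof.
apply: val_inj; rewrite /= !nu_genE /face_gen.
rewrite -[nat_of_ord (lift i k)]/(bump i k).
have [[jn ki] ii] := (ltn_ord j, ltn_ord k, ltn_ord i).
have := nat_swapP j i; have := nat_swapP j (bump i k).
move: (nat_swap j (bump i k)) (nat_swap j i) => a b.
case: ifP => ij; last case: ifP => ij1.
- rewrite tgen_nuE; last lia.
  have := nat_swapP j.-1 k; move: (nat_swap _ _) => c; rewrite /bump; lia.
- rewrite nu1 perm1 /bump; lia.
- rewrite tgen_nuE; last lia.
  have := nat_swapP j k; move: (nat_swap _ _) => c; rewrite /bump; lia.
Qed.

Lemma nu_twin_face n (i : 'I_n.+2) (u : twin n.+1) (k : 'I_n.+1) :
  lift (nu u i) (nu (twin_face i u) k) = nu u (lift i k).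
Proof.
elim/quotW: u => u; rewrite twin_face_pi nu_pi.
elim: u i k => [|j u IH] i k /=.
  by rewrite nu1 /nu_word big_nil !perm1.
rewrite nuM /nu_word big_cons !permM -/(nu_word u) -nu_face_gen.
exact: IH.
Qed.

Lemma nu_degen_genE n i j (x : 'I_n.+2) : j < n ->
  nu (degen_gen n i j) x =
    (if i < j then nat_swap j.+1 x
     else if i == j then nat_swap j (nat_swap j.+1 x)
     else if i == j.+1 then nat_swap j.+1 (nat_swap j x)
     else nat_swap j x) :> nat.
Proof.
move=> jn; rewrite /degen_gen; repeat case: ifP => ?.
all: rewrite ?nuM ?permM !tgen_nuE //; lia.
Qed.

Lemma nu_degen_gen_lift n (i : 'I_n.+1) (j : 'I_n) (k : 'I_n.+1) :
  nu (degen_gen n i j) (lift (widen_ord (leqnSn _) i) k) =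
  lift (widen_ord (leqnSn _) (nu_gen j i)) (nu_gen j k).
Proof.
apply: val_inj; rewrite /= nu_degen_genE //= !nu_genE.
have := nat_swapP j i; have := nat_swapP j k.
have := nat_swapP j (bump i k); have := nat_swapP j.+1 (bump i k).
have := nat_swapP j (nat_swap j.+1 (bump i k)).
have := nat_swapP j.+1 (nat_swap j (bump i k)).
by repeat case: ifP => ?; rewrite /bump; lia.
Qed.

Lemma nu_degen_gen_widen n (i : 'I_n.+1) (j : 'I_n) :
  nu (degen_gen n i j) (widen_ord (leqnSn _) i) =
  widen_ord (leqnSn _) (nu_gen j i).
Proof.
apply: val_inj; rewrite /= nu_degen_genE //= nu_genE.
have := nat_swapP j i; have := nat_swapP j.+1 i.
have := nat_swapP j (nat_swap j.+1 i); have := nat_swapP j.+1 (nat_swap j i).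
by repeat case: ifP => ?; lia.
Qed.

Lemma nu_twin_degen_lift n (i : 'I_n.+1) (u : twin n) (k : 'I_n.+1) :
  nu (twin_degen i u) (lift (widen_ord (leqnSn _) i) k) =
  lift (widen_ord (leqnSn _) (nu u i)) (nu u k).
Proof.
elim/quotW: u => u; rewrite twin_degen_pi nu_pi.
elim: u i k => [|j u IH] i k /=.
  by rewrite nu1 /nu_word big_nil !perm1.
rewrite nuM /nu_word big_cons !permM -/(nu_word u) nu_degen_gen_lift.
exact: IH.
Qed.

Lemma nu_twin_degen_widen n (i : 'I_n.+1) (u : twin n) :
  nu (twin_degen i u) (widen_ord (leqnSn _) i) =
  widen_ord (leqnSn _) (nu u i).
Proof.
elim/quotW: u => u; rewrite twin_degen_pi nu_pi.
elim: u i => [|j u IH] i /=.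
  by rewrite nu1 /nu_word big_nil !perm1.
rewrite nuM /nu_word big_cons !permM -/(nu_word u) nu_degen_gen_widen.
exact: IH.
Qed.

Definition pure n : pred (twin n) := fun u => nu u == 1.

(* [pure_twin n] is PT_{n+1}. *)
Record pure_twin n := PureTwin {
  pure_twin_val :> twin n;
  _ : pure pure_twin_val }.

HB.instance Definition _ n := [isSub for @pure_twin_val n].
HB.instance Definition _ n := [Choice of pure_twin n by <:].

Lemma pure_group n : group_closed (@pure n).
Proof.
split=> [|u v /eqP u1 /eqP v1]; apply/eqP; first exact: nu1.
by rewrite nuM nuV u1 v1 invg1 mulg1.
Qed.

HB.instance Definition _ n :=
  SubChoice_isSubGroup.Build (twin n) (@pure n) (pure_twin n) (@pure_group n).

Lemma pure_nu n (u : pure_twin n) : nu u = 1.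
Proof. exact/eqP/(valP u). Qed.

Lemma pure_face_subproof n (i : 'I_n.+2) (u : pure_twin n.+1) :
  pure (twin_face i u).
Proof.
apply/eqP/permP => k; apply: (@lift_inj _ i).
by have := nu_twin_face i u k; rewrite pure_nu !perm1.
Qed.

Definition pure_face n (i : 'I_n.+2) (u : pure_twin n.+1) : pure_twin n :=
  PureTwin (pure_face_subproof i u).

Lemma pure_degen_subproof n (i : 'I_n.+1) (u : pure_twin n) :
  pure (twin_degen i u).
Proof.
apply/eqP/permP => k; rewrite perm1.
case: (unliftP (widen_ord (leqnSn _) i) k) => [l|] ->.
- by rewrite nu_twin_degen_lift pure_nu !perm1.
- by rewrite nu_twin_degen_widen pure_nu perm1.
Qed.

Definition pure_degen n (i : 'I_n.+1) (u : pure_twin n) : pure_twin n.+1 :=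
  PureTwin (pure_degen_subproof i u).

Definition SPT : simplicial_data := {|
  sobj n := pure_twin n;
  face := pure_face;
  degen := pure_degen |}.

(* Main.v *)
Require Import Defs.
From mathcomp Require Import all_boot perm zify.

Set Implicit Arguments.
Unset Strict Implicit.
Unset Printing Implicit Defensive.

Local Open Scope group_scope.
Local Open Scope quotient_scope.

(** Adding a vertical strand to the left of a twin is an extra degeneracy: it
    commutes with deleting any of the old strands, and deleting the new strand
    undoes it. Hence a pure twin [x] all of whose faces are trivial is the
    [0]-th face of [twin_shift x], whose other faces are the shifted faces of
    [x] and so are trivial. Every Moore cycle of positive degree is thus a Moore
    boundary, by [twin_face_shift0] and [twin_face_shift].

    The simplicial identities say that deleting and doubling different strands
    commute, that doubling a strand twice does not depend on the copy which is
    doubled the second time, and that deleting one of the two copies undoes the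
    doubling. They are statements about strands, not about positions, so each of
    them is proved for all twins, the strands being followed as they move: one
    peels off the first crossing by [twin_face_consg] and [twin_degen_consg],
    and compares the two sides on this crossing by inspection of the positions
    of the strands. For this induction an identity cannot be restricted to one
    relative order of its two strands, as the crossings exchange them; instead,
    for two strands [a] and [b], [lift a k = b] expresses that [b] becomes the
    strand [k] when [a] is deleted, and [liftw a b] is the strand [b] after the
    doubling of a different strand [a]. *)

(** * Peeling off the first crossing *)

Lemma twin_ind n (P : twin n -> Prop) :
  P 1 -> (forall (j : 'I_n) u, P u -> P (tgen n j * u)) -> forall u, P u.
Proof.
move=> P1 Pg; elim/quotW; elim=> [|j u IH]; first by rewrite twin_pi1.
by rewrite -cat1s twin_piM -tgenE; apply: Pg.
Qed.

Lemma twin_face1 n (i : 'I_n.+2) : twin_face i 1 = 1.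
Proof. by rewrite -twin_pi1 twin_face_pi. Qed.

Lemma twin_degen1 n (i : 'I_n.+1) : twin_degen i 1 = 1.
Proof. by rewrite -twin_pi1 twin_degen_pi. Qed.

Lemma twin_face_consg n (i : 'I_n.+2) (j : 'I_n.+1) u :
  twin_face i (tgen n.+1 j * u) = face_gen n i j * twin_face (nu_gen j i) u.
Proof. by rewrite twin_faceM twin_face_tgen nu_tgen. Qed.

Lemma twin_degen_consg n (i : 'I_n.+1) (j : 'I_n) u :
  twin_degen i (tgen n j * u) = degen_gen n i j * twin_degen (nu_gen j i) u.
Proof. by rewrite twin_degenM twin_degen_tgen nu_tgen. Qed.

Lemma twin_face_gen n (i : 'I_n.+2) j : j < n.+1 ->
  twin_face i (tgen n.+1 j) = face_gen n i j.
Proof. by move=> jn; rewrite -(twin_face_tgen i (Ordinal jn)). Qed.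

Lemma twin_degen_gen n (i : 'I_n.+1) j : j < n ->
  twin_degen i (tgen n j) = degen_gen n i j.
Proof. by move=> jn; rewrite -(twin_degen_tgen i (Ordinal jn)). Qed.

Lemma twin_face_gen2 n (i : 'I_n.+2) j k : j < n.+1 -> k < n.+1 ->
  twin_face i (tgen n.+1 j * tgen n.+1 k) =
  face_gen n i j * face_gen n (nat_swap j i) k.
Proof. by move=> jn kn; rewrite twin_faceM !twin_face_gen // tgen_nuE. Qed.

Lemma twin_degen_gen2 n (i : 'I_n.+1) j k : j < n -> k < n ->
  twin_degen i (tgen n j * tgen n k) =
  degen_gen n i j * degen_gen n (nat_swap j i) k.
Proof. by move=> jn kn; rewrite twin_degenM !twin_degen_gen // tgen_nuE. Qed.

Lemma twin_face_face_gen n (k : 'I_n.+2) a j : a < n.+3 -> j < n.+2 ->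
  twin_face k (face_gen n.+1 a j) =
  if a < j then face_gen n k j.-1
  else if a <= j.+1 then 1 else face_gen n k j.
Proof.
move=> an jn; rewrite {1}/face_gen; repeat case: ifP => ?.
all: by rewrite ?twin_face1 ?twin_face_gen //; lia.
Qed.

Lemma twin_degen_face_gen n (k : 'I_n.+1) a j : a < n.+2 -> j < n.+1 ->
  twin_degen k (face_gen n a j) =
  if a < j then degen_gen n k j.-1
  else if a <= j.+1 then 1 else degen_gen n k j.
Proof.
move=> an jn; rewrite {1}/face_gen; repeat case: ifP => ?.
all: by rewrite ?twin_degen1 ?twin_degen_gen //; lia.
Qed.

Lemma twin_face_degen_gen n (k : 'I_n.+2) a j : j < n ->
  twin_face k (degen_gen n a j) =
  if a < j then face_gen n k j.+1
  else if a == j then face_gen n k j.+1 * face_gen n (nat_swap j.+1 k) j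
  else if a == j.+1 then face_gen n k j * face_gen n (nat_swap j k) j.+1
  else face_gen n k j.
Proof.
move=> jn; rewrite {1}/degen_gen; repeat case: ifP => ?.
all: by rewrite ?twin_face_gen2 ?twin_face_gen //; lia.
Qed.

Lemma twin_degen_degen_gen n (k : 'I_n.+2) a j : j < n ->
  twin_degen k (degen_gen n a j) =
  if a < j then degen_gen n.+1 k j.+1
  else if a == j then degen_gen n.+1 k j.+1 * degen_gen n.+1 (nat_swap j.+1 k) j
  else if a == j.+1 then degen_gen n.+1 k j * degen_gen n.+1 (nat_swap j k) j.+1
  else degen_gen n.+1 k j.
Proof.
move=> jn; rewrite {1}/degen_gen; repeat case: ifP => ?.
all: by rewrite ?twin_degen_gen2 ?twin_degen_gen //; lia.
Qed.

(** * Simplicial identities, for twins *)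

(** When the strand [i] is doubled, its copies are in the positions
    [widen_ord _ i] and [liftw i i], and the strand [k] moves to [liftw i k] for
    [k != i]. *)
Notation liftw i := (lift (widen_ord (leqnSn _) i)).

Lemma nu_gen_inj n (j : 'I_n) (a b : 'I_n.+1) :
  (nu_gen j a == nu_gen j b) = (a == b).
Proof. exact/inj_eq/perm_inj. Qed.

(** The type of [k] is stated as ['I_n] instead of ['I_n.+1.-1], as arithmetic
    decision procedures would not identify the values of [k] at these types. *)
Lemma lift_bump n (a : 'I_n.+1) (k : 'I_n) (b : 'I_n.+1) :
  lift a k = b -> bump a k = b.
Proof. by move=> <-. Qed.

(** Decides on which side of each crossing each strand lies; the arithmetic
    contradictions leave only the compatible positions. *)
Ltac split_positions :=
  repeat match goal with |- context [nat_swap ?j ?k] =>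
    have := nat_swapP j k; move: (nat_swap j k) => ? ? end;
  rewrite /face_gen /degen_gen; repeat (case: ifP => ?; try lia).

(** The hypotheses say that [k] is the strand [b] once [a] is deleted, and [l]
    the strand [a] once [b] is deleted. They are preserved when both strands
    move through a crossing, by [nu_face_gen]. *)
Lemma twin_face_face n (a b : 'I_n.+3) (k l : 'I_n.+2) (u : twin n.+2) :
    lift a k = b -> lift b l = a ->
  twin_face k (twin_face a u) = twin_face l (twin_face b u).
Proof.
elim/twin_ind: u a b k l => [|j u IH] a b k l ab ba.
  by rewrite !twin_face1.
rewrite !twin_face_consg !twin_faceM; congr (_ * _); last first.
  by apply: IH; rewrite nu_face_gen ?ab ?ba.
rewrite !twin_face_face_gen //.
move: (lift_bump ab) (lift_bump ba); rewrite /bump => {}ab {}ba.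
by split_positions.
Qed.

Lemma twin_degen_degen n (a b : 'I_n.+1) (u : twin n) : a != b ->
  twin_degen (liftw a b) (twin_degen a u) =
  twin_degen (liftw b a) (twin_degen b u).
Proof.
elim/twin_ind: u a b => [|j u IH] a b ab; first by rewrite !twin_degen1.
rewrite !twin_degen_consg !twin_degenM; congr (_ * _); last first.
  by rewrite !nu_degen_gen_lift; apply: IH; rewrite nu_gen_inj.
rewrite !twin_degen_degen_gen //= /bump; split_positions.
(* The crossing [j] of the two doubled strands becomes four crossings, and the
   two sides differ by the order of [j] and [j.+2], which commute and come
   between the two crossings [j.+1]. *)
all: rewrite // -!mulgA; congr (_ * _).
all: by rewrite !mulgA (tgen_comm _ (ltnSn j.+1)).
Qed.

Lemma twin_degen_degen_copy n (a : 'I_n.+1) (u : twin n) :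
  twin_degen (widen_ord (leqnSn _) a) (twin_degen a u) =
  twin_degen (liftw a a) (twin_degen a u).
Proof.
elim/twin_ind: u a => [|j u IH] a; first by rewrite !twin_degen1.
rewrite !twin_degen_consg !twin_degenM; congr (_ * _); last first.
  by rewrite nu_degen_gen_lift nu_degen_gen_widen; apply: IH.
rewrite !twin_degen_degen_gen //= /bump.
by split_positions; rewrite ?mulgA.
Qed.

(** Here [l] is the strand [a] once [b] is deleted; in particular [a] and [b]
    are different strands. *)
Lemma twin_face_degen n (a b : 'I_n.+2) (l : 'I_n.+1) (u : twin n.+1) :
    lift b l = a ->
  twin_face (liftw a b) (twin_degen a u) = twin_degen l (twin_face b u).
Proof.
elim/twin_ind: u a b l => [|j u IH] a b l ba.
  by rewrite !twin_degen1 !twin_face1 twin_degen1.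
rewrite twin_face_consg twin_degen_consg twin_faceM twin_degenM.
congr (_ * _); last first.
  by rewrite nu_degen_gen_lift; apply: IH; rewrite nu_face_gen ba.
rewrite twin_face_degen_gen // twin_degen_face_gen //=.
move: (lift_bump ba); rewrite /bump => {}ba.
split_positions; rewrite ?mulg1 ?mul1g.
all: by rewrite // ?prednK //; lia.
Qed.

Lemma twin_face_degen_copyl n (a : 'I_n.+1) (u : twin n) :
  twin_face (widen_ord (leqnSn _) a) (twin_degen a u) = u.
Proof.
elim/twin_ind: u a => [|j u IH] a; first by rewrite !twin_degen1 twin_face1.
rewrite !twin_degen_consg !twin_faceM nu_degen_gen_widen IH; congr (_ * _).
rewrite twin_face_degen_gen //= /bump.
by split_positions; rewrite ?mulg1 ?mul1g.
Qed.

Lemma twin_face_degen_copyr n (a : 'I_n.+1) (u : twin n) :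
  twin_face (liftw a a) (twin_degen a u) = u.
Proof.
elim/twin_ind: u a => [|j u IH] a; first by rewrite !twin_degen1 twin_face1.
rewrite !twin_degen_consg !twin_faceM nu_degen_gen_lift IH; congr (_ * _).
rewrite twin_face_degen_gen //= /bump.
by split_positions; rewrite ?mulg1 ?mul1g.
Qed.

(** * Simplicial identities, for pure twins *)

Lemma pure_faceM n (i : 'I_n.+2) : {morph @pure_face n i : u v / u * v}.
Proof.
by move=> u v; apply: val_inj; rewrite /= twin_faceM pure_nu perm1.
Qed.

Lemma pure_degenM n (i : 'I_n.+1) : {morph @pure_degen n i : u v / u * v}.
Proof.
by move=> u v; apply: val_inj; rewrite /= twin_degenM pure_nu perm1.
Qed.

Lemma SPT_simplicial : is_simplicial_group SPT.
Proof.
split.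
- exact: pure_faceM.
- exact: pure_degenM.
- move=> n i j x ij; have jn := ltn_ord j; apply: val_inj.
  by apply: twin_face_face; apply: ord_inj; rewrite /= /bump inordK; lia.
- move=> n i j x; have [i_n jn] := (ltn_ord i, ltn_ord j).
  rewrite leq_eqVlt => /orP [/eqP/val_inj <-|ij]; apply: val_inj => /=.
  + rewrite (_ : inord i = widen_ord (leqnSn _) i); last first.
      by apply: ord_inj; rewrite inordK //=; lia.
    rewrite (_ : inord i.+1 = liftw i i); last first.
      by apply: ord_inj; rewrite inordK /= /bump; lia.
    exact: twin_degen_degen_copy.
  + rewrite (_ : inord i = liftw j i); last first.
      by apply: ord_inj; rewrite inordK /= /bump; lia.
    rewrite (_ : inord j.+1 = liftw i j); last first.
      by apply: ord_inj; rewrite inordK /= /bump; lia.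
    by apply: twin_degen_degen; rewrite -val_eqE /=; lia.
- move=> n i j x ij; have jn := ltn_ord j; apply: val_inj => /=.
  (* [i < j], so the strand [i] keeps its position when [j] is doubled. *)
  rewrite {1}(_ : i = liftw j (inord i)); last first.
    by apply: ord_inj; rewrite /= /bump inordK; lia.
  by apply: twin_face_degen; apply: ord_inj; rewrite /= /bump !inordK; lia.
- move=> n i j x ij; apply: val_inj => /=; case/orP: ij => /eqP ij.
  + rewrite (_ : i = widen_ord (leqnSn _) j); last exact: ord_inj.
    exact: twin_face_degen_copyl.
  + rewrite (_ : i = liftw j j); last first.
      by apply: ord_inj; rewrite /= /bump; lia.
    exact: twin_face_degen_copyr.
- move=> n i j x ij; have i_lt := ltn_ord i; apply: val_inj => /=.
  (* [j.+1 < i], so position [i] holds the strand [i.-1] of [x]. *)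
  rewrite {1}(_ : i = liftw j (inord i.-1)); last first.
    by apply: ord_inj; rewrite /= /bump inordK; lia.
  by apply: twin_face_degen; apply: ord_inj; rewrite /= /bump !inordK; lia.
Qed.

(** * The extra degeneracy *)

(** The twin [u] with a vertical strand added on its left. *)
Definition twin_shift n (u : twin n) : twin n.+1 :=
  \pi_(twin n.+1) (map (lift ord0) (repr u)).

Lemma twin_shift_pi n (w : twin_word n) :
  twin_shift (\pi_(twin n) w) = \pi_(twin n.+1) (map (lift ord0) w).
Proof.
apply: (twin_eq_ind_fun (f := fun w => \pi_(twin n.+1) (map (lift ord0) w))).
- by move=> u v i; rewrite !map_cat; apply/twin_piP/twin_eq_square.
- by move=> u v i j ij; rewrite !map_cat; apply/twin_piP/twin_eq_comm.
- exact: twin_eq_repr.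
Qed.

Lemma twin_shift1 n : twin_shift (1 : twin n) = 1.
Proof. by rewrite -twin_pi1 twin_shift_pi. Qed.

Lemma twin_shiftM n : {morph @twin_shift n : u v / u * v}.
Proof.
elim/quotW=> u; elim/quotW=> v.
by rewrite -twin_piM !twin_shift_pi map_cat twin_piM.
Qed.

Lemma twin_shift_tgen n j : j < n -> twin_shift (tgen n j) = tgen n.+1 j.+1.
Proof.
move=> jn; rewrite -[j]/(nat_of_ord (Ordinal jn)) tgenE twin_shift_pi /=.
by rewrite -tgenE lift0.
Qed.

Lemma nu_gen_lift0 n (j : 'I_n) : nu_gen (lift ord0 j) ord0 = ord0.
Proof. by apply: val_inj; rewrite /= nu_genE. Qed.

Lemma nu_gen_lift n (j : 'I_n) (i : 'I_n.+1) :
  nu_gen (lift ord0 j) (lift ord0 i) = lift ord0 (nu_gen j i).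
Proof.
apply: val_inj; rewrite /= nu_genE !lift0 nu_genE /bump.
by have := nat_swapP j i; have := nat_swapP j.+1 i.+1; lia.
Qed.

Lemma twin_shift_consg n (j : 'I_n) u :
  twin_shift (tgen n j * u) = tgen n.+1 (lift ord0 j) * twin_shift u.
Proof. by rewrite twin_shiftM twin_shift_tgen // lift0. Qed.

Lemma twin_face_shift0 n (u : twin n) : twin_face ord0 (twin_shift u) = u.
Proof.
elim/twin_ind: u => [|j u IH]; first by rewrite twin_shift1 twin_face1.
by rewrite twin_shift_consg twin_face_consg nu_gen_lift0 IH /face_gen lift0.
Qed.

Lemma twin_face_shift n (i : 'I_n.+2) (u : twin n.+1) :
  twin_face (lift ord0 i) (twin_shift u) = twin_shift (twin_face i u).
Proof.
elim/twin_ind: u i => [|j u IH] i.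
  by rewrite twin_shift1 !twin_face1 twin_shift1.
rewrite twin_shift_consg !twin_face_consg nu_gen_lift IH twin_shiftM.
congr (_ * _); rewrite !lift0 /face_gen !ltnS.
have [i_lt j_lt] := (ltn_ord i, ltn_ord j).
case: ifP => ?; last case: ifP => ?.
- by rewrite twin_shift_tgen /= ?prednK //; lia.
- by rewrite twin_shift1.
- by rewrite twin_shift_tgen //; lia.
Qed.

Lemma nu_shift0 n (u : twin n) : nu (twin_shift u) ord0 = ord0.
Proof.
elim/twin_ind: u => [|j u IH]; first by rewrite twin_shift1 nu1 perm1.
by rewrite twin_shift_consg nuM permM nu_tgen -/(nu_gen _) nu_gen_lift0.
Qed.

(** The new strand stays leftmost, so the other strands are permuted as they are
    once it is deleted, which gives back [u]. *)
Lemma pure_shift n (u : pure_twin n) : pure (twin_shift u).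
Proof.
apply/eqP/permP => k; rewrite perm1; case: (unliftP ord0 k) => [l|] ->.
- by rewrite -nu_twin_face nu_shift0 twin_face_shift0 pure_nu perm1.
- exact: nu_shift0.
Qed.

Theorem proposition6p4 :
  exists h : is_simplicial_group SPT, contractible (SimplicialGroup h).
Proof.
exists SPT_simplicial => -[//|n] _; elim/quotW=> x; apply/esym.
apply: homotopy_eq; rewrite -valM invg1 mul1g.
exists (PureTwin (pure_shift (val x : pure_twin n.+1))); last first.
  by apply: val_inj; apply: twin_face_shift0.
move=> i; case: (unliftP ord0 i) => [k -> _|-> //]; apply: val_inj => /=.
have /forallP /(_ k) /eqP xk := valP x.
by rewrite twin_face_shift -[twin_face k _]/(val (face SPT k (val x))) xk
  twin_shift1.
Qed.
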